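(* (a) Let $\mu\in\mathcal M_0$ and let $F:D\to D$ be the associated conformal map. The domain $\Omega:=F(D)\subset D$ has the following two properties: (i) if $Re^{i\alpha}\in\Omega$, then $re^{i\alpha}\in\Omega$ for all $0\le r<R$; (ii) $re^{i\alpha}\in\Omega$ if and only if $re^{-i\alpha}\in\Omega$. (b) A subset $\Omega\subset D$, $\Omega\neq\emptyset$, is open and has the properties (i), (ii) if and only if there exists an upper semicontinuous function $h:S^1\to[0,1)$ with $h(e^{-i\alpha})=h(e^{i\alpha})$ such that $$\Omega=\Omega_h\equiv\{re^{i\alpha}:0\le r<1-h(e^{i\alpha})\}.$$
   Context: Jacobi matrices: $\mathcal J_2$ is the set of all Jacobi matrices $(Ju)_n=a_nu_{n+1}+a_{n-1}u_{n-1}+b_nu_n$ on $\ell^2(\mathbb Z)$ with bounded coefficients $a_n\ge 0$, $b_n\in\mathbb R$ and operator norm $\|J\|\le 2$, made into a compact metric space by $d(J,J')=\sum_{n\in\mathbb Z}2^{-|n|}(|a_n-a_n'|+|b_n-b_n'|)$. The shift $S(a,b)_n=(a,b)_{n+1}$ is a homeomorphism of $\mathcal J_2$. $\mathcal M_0$ is the set of $S$-invariant Borel probability measures $\mu$ on $\mathcal J_2$ with $\int\ln a_0(J)\,d\mu(J)>-\infty$. For $\mu\in\mathcal M_0$, $A>0$ is defined by $\ln A=\int\ln a_0\,d\mu$; the density of states measure $dk$ is the probability measure on $[-2,2]$ with $\int f\,dk=\int d\mu(J)\int f(t)\,d\rho_0(t;J)$ for all $f\in C[-2,2]$, where $d\rho_0(t;J)=d\|E_J(t)\delta_0\|^2$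 is the spectral measure of $J$ and $\delta_0$; and for $z\in\mathbb C^+$ (open upper half plane) $w(z)=\ln A-\int_{[-2,2]}\ln(t-z)\,dk(t)$, with the branch of the logarithm satisfying $\mathrm{Im}\,\ln\zeta\in(-\pi,0)$ for $\zeta$ in the open lower half plane. $D=\{|z|<1\}$ is the unit disk, $D^+=D\cap\mathbb C^+$, $S^1=\partial D$. The associated conformal map $F:D\to F(D)\subset D$ is the holomorphic extension to $D$, by reflection $F(\overline\zeta)=\overline{F(\zeta)}$, of $F(\zeta)=e^{w(-\zeta-1/\zeta)}$, $\zeta\in D^+$. (This extension exists, is injective, and satisfies $F(0)=0$, $F'(0)=A$.) In polar coordinates $re^{i\alpha}$, $Re^{i\alpha}$ one has $r,R\ge 0$ and $\alpha\in\mathbb R$. *)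

(* Defs.v *)
From HB Require Import structures.
From mathcomp Require Import all_boot all_order all_algebra.
From mathcomp Require Import all_classical all_reals all_analysis.
From mathcomp Require Import complex.

Set Implicit Arguments.
Unset Strict Implicit.
Unset Printing Implicit Defensive.

Import Order.TTheory GRing.Theory Num.Theory numFieldNormedType.Exports.
Import ComplexField.Normc.

Local Open Scope classical_set_scope.
Local Open Scope complex_scope.
Local Open Scope ring_scope.

(* The usual topology of the complex plane: without this instance only the
   alias [R[i]^o] is a normed module. *)
HB.instance Definition _ (R : realType) := NormedModule.copy R[i] R[i]^o.

Section l2.
Context {R : realType}.
Implicit Types u v : int -> R[i].

Definition l2norm u : \bar R :=
  sqrte (\esum_(n in [set: int]) ((normc (u n) ^+ 2)%:E)).

Definition l2 : set (int -> R[i]) := [set u | (l2norm u < +oo)%E].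

Definition delta0 : int -> R[i] := fun n => (n == 0)%:R.

(* Only used for absolutely convergent series, so that symmetric partial sums
   give the right value. *)
Definition zsum (f : int -> R[i]) : R[i] :=
  limn (fun N : nat => \sum_(i < N.*2.+1) f (i%:Z - N%:Z)).

Definition l2inner u v : R[i] := zsum (fun n => (u n)^*%C * v n).

Definition opnorm (T : (int -> R[i]) -> int -> R[i]) : \bar R :=
  ereal_sup [set l2norm (T u) | u in [set u | (l2norm u <= 1)%E]].

End l2.

Definition jacobi_op {R : realType} (a b : int -> R) (u : int -> R[i]) :
    int -> R[i] :=
  fun n => (a n)%:C%C * u (n + 1) + (a (n - 1))%:C%C * u (n - 1)
           + (b n)%:C%C * u n.

Definition jacobi2_axiom {R : realType} (a b : int -> R) : Prop :=
  [/\ forall n, 0 <= a n,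
      exists M : R, forall n, `|a n| <= M /\ `|b n| <= M &
      (opnorm (jacobi_op a b) <= 2%:E)%E].

Record jacobi2 (R : realType) := Jacobi2 {
  offdiag : int -> R ;
  diag : int -> R ;
  jacobi2P : jacobi2_axiom offdiag diag
}.

Definition jacobi_mx {R : realType} (J : jacobi2 R) :
    (int -> R[i]) -> int -> R[i] :=
  jacobi_op (offdiag J) (diag J).

Section jacobi2_theory.
Context {R : realType}.
Implicit Types (a b : int -> R) (u v : int -> R[i]) (J : jacobi2 R).

Lemma jacobi2_inj J J' :
  offdiag J = offdiag J' -> diag J = diag J' -> J = J'.
Proof.
case: J J' => [a b p] [a' b' p'] /= aa' bb'.
by move: p p'; rewrite aa' bb' => p p'; congr Jacobi2; exact: Prop_irrelevance.
Qed.

Lemma l2norm_shift (k : int) u : l2norm (fun n => u (n + k)) = l2norm u.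
Proof.
congr sqrte; symmetry; apply: (reindex_esum setT setT (fun n => n + k)).
by rewrite setTT_bijective; exists (fun n => n - k) => n; rewrite ?addrK ?subrK.
Qed.

Lemma jacobi2_axiom0 : jacobi2_axiom (fun=> 0) (fun=> 0 : R).
Proof.
split=> //; first by exists 0 => n; rewrite normr0.
apply: ge_ereal_sup => _ [u _ <-].
rewrite /l2norm esum1 ?sqrte0 ?lee_fin// => n _.
by rewrite /jacobi_op !mul0r !addr0 normc0 expr0n.
Qed.

Lemma jacobi2_axiom_shift a b : jacobi2_axiom a b ->
  jacobi2_axiom (fun n => a (n + 1)) (fun n => b (n + 1)).
Proof.
move=> [a_ge0 [M abM] ab2]; split => [n|//|]; first exact: a_ge0.
  by exists M => n; exact: abM.
apply: ge_ereal_sup => _ [u u1 <-]; apply: le_trans ab2.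
pose v : int -> R[i] := fun n => u (n + (- 1)).
have -> : jacobi_op (fun n => a (n + 1)) (fun n => b (n + 1)) u =
          (fun n => jacobi_op a b v (n + 1)).
  by apply/funext => n; rewrite /jacobi_op /v !addrK.
rewrite l2norm_shift; apply: ereal_sup_ubound; exists v => //=.
by rewrite l2norm_shift.
Qed.

Definition jacobi_dist J J' : R :=
  fine (\esum_(n in [set: int])
    ((2 ^- `|n|%N *
      (`|offdiag J n - offdiag J' n| + `|diag J n - diag J' n|))%:E)).

Let dterm J J' (n : int) : \bar R :=
  (2 ^- `|n|%N *
      (`|offdiag J n - offdiag J' n| + `|diag J n - diag J' n|))%:E.

Let dterm_ge0 J J' n : (0 <= dterm J J' n)%E.
Proof. by rewrite lee_fin mulr_ge0 ?invr_ge0 ?exprn_ge0 ?addr_ge0. Qed.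

Let esum_half (c : R) (f : nat -> \bar R) : (forall n, 0 <= f n)%E ->
  (forall n, f n <= (c / (2 ^ (n + 1))%:R)%:E)%E ->
  (\esum_(n in [set: nat]) f n < +oo)%E.
Proof.
move=> f0 fc.
have c0 n : (0 <= (c / (2 ^ (n + 1))%:R)%:E)%E by exact: le_trans (fc n).
apply: (@le_lt_trans _ _
    (\esum_(n in [set: nat]) (c / (2 ^ (n + 1))%:R)%:E)%E).
  by apply: le_esum => n _; exact: fc.
rewrite -nneseries_esumT//.
by rewrite (cvg_lim _ (@cvg_geometric_eseries_half R c 0))//= ltry.
Qed.

Lemma jacobi_dist_fin J J' : \esum_(n in [set: int]) dterm J J' n \is a fin_num.
Proof.
have dge0 n : setT n -> (0 <= dterm J J' n)%E by move=> _; exact: dterm_ge0.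
rewrite ge0_fin_numE ?esum_ge0//.
have [_ [M JM] _] := jacobi2P J; have [_ [M' JM'] _] := jacobi2P J'.
pose c := (M + M') + (M + M').
have dc (n : int) : `|offdiag J n - offdiag J' n| + `|diag J n - diag J' n| <= c.
  have [? ?] := JM n; have [? ?] := JM' n.
  by rewrite lerD// (le_trans (ler_normB _ _))// lerD.
rewrite (esumID (range Posz) setT (dterm J J') dge0).
have -> : ([set: int] `&` ~` range Posz)%classic = range Negz.
  rewrite setTI; apply/seteqP; split => [[n|n] /=|_ [n _ <-] [m _]//].
    by move=> h; exfalso; apply: h; exists n.
  by move=> _; exists n.
rewrite setTI lte_add_pinfty//.
- rewrite (reindex_esum setT _ Posz); last by apply: inj_bij => m n _ _ [].
  apply: (@esum_half (c * 2)) => n; first exact: dterm_ge0.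
  rewrite lee_fin/= addn1 expnS natrM invfM -!mulrA (mulrA 2) divff ?mul1r//.
  by rewrite mulrC natrX ler_wpM2r// invr_ge0 exprn_ge0.
- rewrite (reindex_esum setT _ Negz); last by apply: inj_bij => m n _ _ [].
  apply: (@esum_half c) => n; first exact: dterm_ge0.
  rewrite lee_fin/= addn1.
  by rewrite mulrC natrX ler_wpM2r// invr_ge0 exprn_ge0.
Qed.

Lemma jacobi_distxx J : jacobi_dist J J = 0.
Proof.
by rewrite /jacobi_dist esum1// => n _; rewrite !subrr normr0 addr0 mulr0.
Qed.

Lemma jacobi_dist_eq0 J J' : jacobi_dist J J' = 0 -> J = J'.
Proof.
move=> d0.
have d0E : \esum_(n in [set: int]) dterm J J' n = 0%E.
  by rewrite -[LHS]fineK ?jacobi_dist_fin// -/(jacobi_dist J J') d0.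
have t0 n : `|offdiag J n - offdiag J' n| + `|diag J n - diag J' n| = 0.
  have : (dterm J J' n <= 0)%E.
    rewrite -d0E; apply: esum_ge; exists [set n]; first by split.
    by rewrite fsbig_set1.
  rewrite lee_fin pmulr_rle0 ?invr_gt0 ?exprn_gt0// => h.
  by apply/eqP; rewrite eq_le h addr_ge0.
apply: jacobi2_inj; apply/funext => n; apply/eqP; rewrite -subr_eq0 -normr_eq0;
  have /eqP := t0 n; rewrite paddr_eq0// => /andP[]//.
Qed.

Lemma jacobi_dist_sym J J' : jacobi_dist J J' = jacobi_dist J' J.
Proof.
congr fine; apply: eq_esum => n _.
by rewrite distrC (distrC (diag J n)).
Qed.

Lemma jacobi_dist_triangle J' J J'' :
  jacobi_dist J J'' <= jacobi_dist J J' + jacobi_dist J' J''.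
Proof.
rewrite -fineD ?jacobi_dist_fin// -esumD; do ?by move=> n _; exact: dterm_ge0.
apply: fine_le; first exact: jacobi_dist_fin.
  rewrite esumD; do ?by move=> n _; exact: dterm_ge0.
  by rewrite fin_numD !jacobi_dist_fin.
apply: le_esum => n _; rewrite lee_fin -mulrDr ler_wpM2l ?invr_ge0 ?exprn_ge0//.
by rewrite addrACA lerD ?ler_distD.
Qed.

End jacobi2_theory.

HB.instance Definition _ (R : realType) := gen_eqMixin (jacobi2 R).
HB.instance Definition _ (R : realType) := gen_choiceMixin (jacobi2 R).
HB.instance Definition _ (R : realType) :=
  isPointed.Build (jacobi2 R) (Jacobi2 (@jacobi2_axiom0 R)).
HB.instance Definition _ (R : realType) :=
  isMetric.Build R (jacobi2 R) (@jacobi_distxx R) (@jacobi_dist_eq0 R)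
    (@jacobi_dist_sym R) (@jacobi_dist_triangle R).
(* The Borel sigma-algebra of the metric [jacobi_dist]. *)
HB.instance Definition _ (R : realType) :=
  @isMeasurable.Build (sigma_display (@open (jacobi2 R))) (jacobi2 R)
    <<s @open (jacobi2 R) >> (@sigma_algebra0 _ setT _)
    (@sigma_algebraC _ _) (@sigma_algebra_bigcup _ setT _).

Definition jacobi_shift {R : realType} (J : jacobi2 R) : jacobi2 R :=
  Jacobi2 (jacobi2_axiom_shift (jacobi2P J)).

(* [lne 0 = -oo], whereas [ln 0 = 0]. *)
Definition M0 {R : realType} (mu : probability (jacobi2 R) R) : Prop :=
  (forall B : set (jacobi2 R), measurable B ->
     mu (@jacobi_shift R @^-1` B) = mu B) /\
  (-oo < \int[mu]_J lne (offdiag J 0)%:E)%E.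

Definition lnA {R : realType} (mu : probability (jacobi2 R) R) : R :=
  fine (\int[mu]_J lne (offdiag J 0)%:E)%E.

Definition interval22 {R : realType} : set R := `[-2, 2]%classic.

Section spectral.
Context {R : realType}.
Implicit Types (T P : (int -> R[i]) -> int -> R[i]) (u v : int -> R[i]).

Definition orth_projection P : Prop :=
  [/\ forall u, l2 u -> l2 (P u),
      forall (c : R[i]) u v, l2 u -> l2 v ->
        P (fun n => c * u n + v n) = (fun n => c * P u n + P v n),
      forall u, l2 u -> P (P u) = P u &
      forall u v, l2 u -> l2 v -> l2inner (P u) v = l2inner u (P v)].

(* [nu] is the Stieltjes measure [dg]. *)
Definition is_stieltjes (nu : {measure set R -> \bar R}) (g : R -> \bar R) :=
  forall t : R, nu `]-oo, t]%classic = g t.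

(* [E] is the spectral family of the bounded self-adjoint operator [T]; the
   last clause is [T = \int t dE(t)] in the weak sense (on a complex Hilbert
   space the quadratic form determines the operator). *)
Definition is_spectral_family T (E : R -> (int -> R[i]) -> int -> R[i]) :
    Prop :=
  [/\ forall t, orth_projection (E t),
      forall s t u, s <= t -> l2 u -> E s (E t u) = E s u,
      forall t u, l2 u ->
        l2norm (fun n => E s u n - E t u n) @[s --> t^'+] --> 0%E,
      exists M : R, forall u, l2 u ->
        (forall t, t < - M -> E t u = (fun=> 0)) /\
        (forall t, M <= t -> E t u = u) &
      forall u, l2 u -> exists2 nu : {measure set R -> \bar R},
        is_stieltjes nu (fun t => l2norm (E t u) ^+ 2)%E &
        l2inner u (T u) = (\int[nu]_t t)%:C%C].

(* [d rho(t) = d ||E(t) u||^2] *)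
Definition is_spectral_measure T u (rho : {measure set R -> \bar R}) : Prop :=
  exists2 E, is_spectral_family T E &
    is_stieltjes rho (fun t => l2norm (E t u) ^+ 2)%E.

Definition is_density_of_states (mu : probability (jacobi2 R) R)
    (dk : probability R R) : Prop :=
  dk interval22 = 1%E /\
  exists2 rho : jacobi2 R -> {measure set R -> \bar R},
    forall J, is_spectral_measure (jacobi_mx J) delta0 (rho J) &
    forall f : R -> R, {within interval22, continuous f} ->
      (\int[dk]_(t in interval22) (f t)%:E
       = \int[mu]_J \int[rho J]_(t in interval22) (f t)%:E)%E.

End spectral.

Section complex_functions.
Context {R : realType}.
Implicit Types z : R[i].

Definition expC z : R[i] :=
  (expR (complex.Re z))%:C%C * (cos (complex.Im z) +i* sin (complex.Im z))%C.

(* The branch of the logarithm on the lower half plane with imaginary part in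
   [(-pi, 0)], see [lnC_lowerK] and [Im_lnC_lower]. *)
Definition lnC_lower z : R[i] :=
  (ln (normc z) +i* (- acos (complex.Re z / normc z)))%C.

Let Re_bound z : complex.Im z < 0 -> -1 < complex.Re z / normc z < 1.
Proof.
case: z => x y /= y0.
have n0 : 0 < Num.sqrt (x ^+ 2 + y ^+ 2).
  by rewrite sqrtr_gt0 ltr_wpDl ?sqr_ge0// exprn_even_gt0//= lt_eqF.
rewrite -ltr_norml normrM normfV (gtr0_norm n0) ltr_pdivrMr// mul1r.
rewrite -sqrtr_sqr ltr_sqrt ?ltrDl; first by rewrite exprn_even_gt0//= lt_eqF.
by rewrite ltr_wpDl ?sqr_ge0// exprn_even_gt0//= lt_eqF.
Qed.

Lemma Im_lnC_lower z : complex.Im z < 0 ->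
  - pi < complex.Im (lnC_lower z) < 0.
Proof.
move=> /Re_bound /andP[lo hi] /=.
by rewrite ltrN2 oppr_lt0 acos_ltpi ?acos_gt0 ?(ltW lo) ?(ltW hi) ?lo ?hi.
Qed.

Lemma lnC_lowerK z : complex.Im z < 0 -> expC (lnC_lower z) = z.
Proof.
move=> z0; have /andP[lo hi] := Re_bound z0.
have bd : -1 <= complex.Re z / normc z <= 1 by rewrite !ltW.
rewrite /expC /= cosN sinN sin_acos// acosK ?in_itv//=.
case: z z0 {lo hi} bd => x y /= y0 bd.
set m := Num.sqrt (x ^+ 2 + y ^+ 2).
have m0 : 0 < m.
  by rewrite sqrtr_gt0 ltr_wpDl ?sqr_ge0// exprn_even_gt0//= lt_eqF.
rewrite lnK ?posrE//.
have -> : 1 - (x / m) ^+ 2 = (y / m) ^+ 2.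
  rewrite !expr_div_n -(divff (x := m ^+ 2)) ?expf_neq0 ?gt_eqF//.
  rewrite -mulrBl sqr_sqrtr ?addr_ge0 ?sqr_ge0//.
  by rewrite addrC addKr.
rewrite sqrtr_sqr ltr0_norm ?pmulr_llt0 ?invr_gt0// opprK.
apply/eqP; rewrite eq_complex /= !mul0r subr0 addr0.
by rewrite !(mulrC m) !divfK ?(gt_eqF m0)// !eqxx.
Qed.

Definition Cintegral (nu : {measure set R -> \bar R}) (D : set R)
    (f : R -> R[i]) : R[i] :=
  (\int[nu]_(t in D) complex.Re (f t) +i* \int[nu]_(t in D) complex.Im (f t))%C.

Definition w_function (mu : probability (jacobi2 R) R) (dk : probability R R)
    z : R[i] :=
  (lnA mu)%:C%C - Cintegral dk interval22 (fun t => lnC_lower (t%:C%C - z)).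

Definition unit_disk : set R[i] := [set z | normc z < 1].

Definition unit_circle : set R[i] := [set z | normc z = 1].

Definition is_associated_conformal_map (mu : probability (jacobi2 R) R)
    (F : R[i] -> R[i]) : Prop :=
  exists2 dk : probability R R, is_density_of_states mu dk &
    [/\ forall zeta, unit_disk zeta -> unit_disk (F zeta),
        forall zeta, unit_disk zeta -> derivable F zeta 1,
        forall zeta, unit_disk zeta -> F (zeta^*)%C = ((F zeta)^*)%C &
        forall zeta, unit_disk zeta -> 0 < complex.Im zeta ->
          F zeta = expC (w_function mu dk (- zeta - zeta^-1))].

Definition polar (r alpha : R) : R[i] := (r * cos alpha +i* (r * sin alpha))%C.

Definition radial (Omega : set R[i]) : Prop :=
  forall r r' alpha : R, 0 <= r < r' ->
    Omega (polar r' alpha) -> Omega (polar r alpha).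

Definition reflection_symmetric (Omega : set R[i]) : Prop :=
  forall r alpha : R, 0 <= r ->
    (Omega (polar r alpha) <-> Omega (polar r (- alpha))).

(* A function on the circle is represented by a total function [h] of which
   only the values on [A = unit_circle] matter. *)
Definition upper_semicontinuous_in (A : set R[i]) (h : R[i] -> R) : Prop :=
  forall zeta, A zeta -> forall c : R, h zeta < c ->
    \forall xi \near within A (nbhs zeta), h xi < c.

Definition radial_domain (h : R[i] -> R) : set R[i] :=
  [set z | exists r alpha : R,
             0 <= r < 1 - h (polar 1 alpha) /\ z = polar r alpha].

End complex_functions.

(* Main.v *)
(* For z = x + iy in the upper half plane, Im w(z) is the integral of
   pi/2 - atan((t - x)/y) against dk(t), so it is strictly increasing in x.
   Each of its level sets is therefore the graph of a continuous function of y,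
   along which Re w is continuous and tends to -oo as y -> +oo (as
   Re w <= ln A - ln y): by the intermediate value theorem the range of w
   contains the half line to the left of each of its points, and exp turns half
   lines into radii. The real axis is treated by the intermediate value theorem
   for F, which is real there and satisfies F(0) = 0.
   For (b), h is one minus the supremum of the radii in a given direction. *)
Require Import Defs.
From mathcomp Require Import all_boot all_order all_algebra.
From mathcomp Require Import all_classical all_reals all_analysis.
From mathcomp Require Import complex measurable_realfun ring lra.
Import Order.TTheory GRing.Theory Num.Theory numFieldNormedType.Exports.
Import ComplexField.Normc.
Local Open Scope classical_set_scope.
Local Open Scope ring_scope.

(** * Integration of continuous functions against a probability measure carried by [[-2, 2]] *)

Section integrals22.
Context {R : realType}.
Variable (nu : probability R R).
Hypothesis nu1 : nu interval22 = 1%E.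
Implicit Types f g : R -> R.

Lemma measurable_interval22 : measurable (@interval22 R).
Proof. exact: measurable_itv. Qed.

Lemma continuous_integrable22 f : continuous f ->
  nu.-integrable interval22 (EFin \o f).
Proof.
move=> cf; apply: measurable_bounded_integrable.
- exact: measurable_interval22.
- rewrite -ge0_fin_numE ?measure_ge0//.
  exact: fin_num_measure measurable_interval22.
- exact: (@subspace_continuous_measurable_fun _ _ _ measurable_interval22
    (continuous_subspaceT cf)).
- have cf' : {within (interval22 : set R^o), continuous (f : R -> R^o)}.
    exact: continuous_subspaceT.
  have /compact_bounded[M [_ fM]] :=
    continuous_compact cf' (@segment_compact _ _ _).
  by exists M; split; rewrite ?num_real// => ? ? ? ?; exact: fM.
Qed.

Lemma Rintegral22_cst (c : R) : \int[nu]_(t in interval22) c = c.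
Proof.
rewrite Rintegral_cst; last exact: measurable_interval22.
by rewrite [X in fine X]nu1 mulr1.
Qed.

Lemma le_Rintegral22 f g : continuous f -> continuous g ->
  (forall t, -2 <= t <= 2 -> f t <= g t) ->
  \int[nu]_(t in interval22) f t <= \int[nu]_(t in interval22) g t.
Proof.
move=> cf cg fg; apply: le_Rintegral => //; first exact: measurable_interval22.
- exact: continuous_integrable22.
- exact: continuous_integrable22.
Qed.

Lemma Rintegral22B f g : continuous f -> continuous g ->
  \int[nu]_(t in interval22) (f t - g t) =
  \int[nu]_(t in interval22) f t - \int[nu]_(t in interval22) g t.
Proof.
move=> cf cg; rewrite RintegralB//; first exact: measurable_interval22.
- exact: continuous_integrable22.
- exact: continuous_integrable22.
Qed.

(** Strictness survives integration because the continuous function [g - f] attains a positive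
    minimum on the compact interval, which has mass 1. *)
Lemma lt_Rintegral22 f g : continuous f -> continuous g ->
  (forall t, -2 <= t <= 2 -> f t < g t) ->
  \int[nu]_(t in interval22) f t < \int[nu]_(t in interval22) g t.
Proof.
move=> cf cg fg.
have cgf : continuous (fun t => g t - f t).
  by move=> t; apply: continuousB; [exact: cg | exact: cf].
have m22 : -2 <= 2 :> R by lra.
have [c c22 cmin] := EVT_min m22 (continuous_subspaceT cgf).
rewrite -subr_gt0 -Rintegral22B//.
apply: (@lt_le_trans _ _ (g c - f c)); first by rewrite subr_gt0 fg.
rewrite -[leLHS]Rintegral22_cst; apply: le_Rintegral22 => //.
by move=> ?; exact: cvg_cst.
Qed.

Lemma Rintegral22_dist f g (e : R) : continuous f -> continuous g ->
  (forall t, -2 <= t <= 2 -> `|f t - g t| <= e) ->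
  `|\int[nu]_(t in interval22) f t - \int[nu]_(t in interval22) g t| <= e.
Proof.
move=> cf cg fg.
have cfg : continuous (fun t => f t - g t).
  by move=> t; apply: continuousB; [exact: cf | exact: cg].
rewrite -Rintegral22B// ler_norml -{1}[e]opprK opprK.
rewrite -[- e]Rintegral22_cst -[X in _ && (_ <= X)]Rintegral22_cst.
apply/andP; split; apply: le_Rintegral22 => //; try by move=> ?; exact: cvg_cst.
- by move=> t /fg; rewrite ler_norml => /andP[].
- by move=> t /fg; rewrite ler_norml => /andP[].
Qed.

End integrals22.

(** * Real and imaginary parts of the logarithm under the integral defining [w] *)

Section kernels.
Context {R : realType}.
Implicit Types (t x y : R).

Lemma atan_lipschitz x y : `|atan x - atan y| <= `|x - y|.
Proof.
wlog xy : x y / x < y => [hw|].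
  have [/hw//|yx|->] := ltgtP x y; last by rewrite !subrr.
  by rewrite distrC [leRHS]distrC hw.
have catan : {within `[x, y], continuous atan}.
  exact: continuous_subspaceT (@continuous_atan R).
have [c _ e] := MVT xy (fun z _ => is_derive1_atan z) catan.
rewrite distrC e [leRHS]distrC normrM ler_piMl//.
have c1 : 1 <= 1 + c ^+ 2 by rewrite lerDl sqr_ge0.
by rewrite gtr0_norm ?invr_gt0 ?(lt_le_trans _ c1)// invf_le1
  ?(lt_le_trans _ c1).
Qed.

(** For [b <= a] this is [ln (1 + u) <= u] at [u = (a - b) / b]. *)
Lemma ln_lipschitz (m a b : R) : 0 < m -> m <= a -> m <= b ->
  `|ln a - ln b| <= `|a - b| / m.
Proof.
move=> m0; wlog ab : a b / b <= a => [hw|] ma mb.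
  have [/hw|/ltW/hw h] := leP b a; first exact.
  by rewrite distrC [`|a - b|]distrC h.
have b0 := lt_le_trans m0 mb; have a0 := lt_le_trans m0 ma.
rewrite !ger0_norm ?subr_ge0 ?ler_ln ?posrE// -ln_div ?posrE//.
have -> : a / b = 1 + (a - b) / b by rewrite mulrBl divff ?gt_eqF// addrC subrK.
apply: (@le_trans _ _ ((a - b) / b)).
  apply: le_ln1Dx; rewrite (lt_le_trans _ (_ : 0 <= _))//.
  by rewrite divr_ge0 ?subr_ge0// ltW.
by rewrite ler_wpM2l ?subr_ge0// lef_pV2 ?posrE.
Qed.

(** Minus the argument of [t - z] for [z = x + iy] with [0 < y]. In terms of [atan], rather than the
    [acos] of [lnC_lower], monotonicity in [x] and Lipschitz bounds are immediate. *)
Definition arg_kernel x y t : R := pi / 2 - atan ((t - x) / y).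

Definition log_kernel x y t : R := ln (normc ((t - x) +i* y)%C).

Lemma continuous_arg_kernel x y : continuous (arg_kernel x y).
Proof.
move=> t; apply: cvgB; first exact: cvg_cst.
apply: continuous_comp; last exact: continuous_atan.
apply: cvgM; last exact: cvg_cst.
by apply: cvgB; [exact: cvg_id | exact: cvg_cst].
Qed.

Lemma ge_normc_Im x y : y <= normc (x +i* y)%C.
Proof.
rewrite (le_trans (ler_norm y))//= -sqrtr_sqr ler_wsqrtr//.
by rewrite lerDr sqr_ge0.
Qed.

Lemma normc_Complex_le x y : normc (x +i* y)%C <= `|x| + `|y|.
Proof.
rewrite /= -[leRHS]ger0_norm ?addr_ge0// -sqrtr_sqr ler_wsqrtr// sqrrD.
rewrite !real_normK ?num_real// lerD2r lerDl mulrn_wge0 // mulr_ge0.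
Qed.

(** Both moduli are at least [m], where [ln] is Lipschitz with constant [1 / m], and the modulus
    changes by at most the modulus of the difference. *)
Lemma log_kernel_dist (m x y x' y' t : R) : 0 < m -> m <= y -> m <= y' ->
  `|log_kernel x y t - log_kernel x' y' t| <= (`|x - x'| + `|y - y'|) / m.
Proof.
move=> m0 my my'; apply: le_trans.
  apply: ln_lipschitz m0 _ _; apply: le_trans (ge_normc_Im _ _) => //.
rewrite ler_wpM2r ?invr_ge0 ?(ltW m0)//.
have key (a b a' b' : R) :
    normc (a +i* b)%C - normc (a' +i* b')%C <= `|a - a'| + `|b - b'|.
  rewrite lerBlDr.
  apply: (@le_trans _ _
      (normc ((a - a') +i* (b - b'))%C + normc (a' +i* b')%C)); last first.
    by apply: lerD => //; exact: normc_Complex_le.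
  have -> : (a +i* b = ((a - a') +i* (b - b')) + (a' +i* b'))%C.
    by apply/eqP; rewrite eq_complex /= !subrK !eqxx.
  exact: le_normcD.
have e : `|t - x - (t - x')| = `|x - x'| by rewrite -normrN; congr `|_|; ring.
rewrite ler_norml; apply/andP; split.
  by rewrite lerNl opprB -e (distrC (t - x)) (distrC y); exact: key.
by rewrite -e; exact: key.
Qed.

Lemma continuous_log_kernel x y : 0 < y -> continuous (log_kernel x y).
Proof.
move=> y0 t; apply/cvgrPdist_le => e e0; near=> s.
(* The kernel depends only on [t - x], so the estimate in [x] also gives continuity in [t]. *)
have shift u : log_kernel x y u = log_kernel (x - u) y 0.
  by rewrite /log_kernel opprB add0r.
rewrite [log_kernel x y t]shift [log_kernel x y s]shift.
apply: le_trans (log_kernel_dist y _ _ _ _ _ y0 _ _) _ => //.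
rewrite subrr normr0 addr0 ler_pdivrMr// (_ : _ - _ = s - t); last by ring.
rewrite distrC; near: s; apply: cvgr_dist_le; first exact: cvg_id.
by rewrite mulr_gt0.
Unshelve. all: by end_near. Qed.

Lemma log_kernel_ge x y t : 0 < y -> ln y <= log_kernel x y t.
Proof.
by move=> y0; rewrite ler_ln ?posrE ?(lt_le_trans y0) ?ge_normc_Im.
Qed.

Lemma arg_kernel_bound x y t : 0 < arg_kernel x y t < pi.
Proof.
have := atan_gtNpi2 ((t - x) / y); have := atan_ltpi2 ((t - x) / y).
by rewrite /arg_kernel; lra.
Qed.

Lemma lnC_lowerE x y t : 0 < y ->
  lnC_lower ((t - x) +i* - y)%C = (log_kernel x y t +i* - arg_kernel x y t)%C.
Proof.
move=> y0; rewrite /lnC_lower /log_kernel /= sqrrN; congr (_ +i* - _)%C.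
have /andP[a0 api] := arg_kernel_bound x y t.
(* Both arguments lie in [[0, pi]], so it suffices to compare cosines: with [s = (t - x) / y], both
   equal [s / sqrt (1 + s ^+ 2)]. *)
rewrite -[RHS]cosK ?in_itv/= ?ltW//; congr acos.
rewrite /arg_kernel -(opprB (atan _)) cosN cosBpihalf.
set s := (t - x) / y.
have cs : cos (atan s) != 0.
  by rewrite gt_eqF// cos_gt0_pihalf// atan_gtNpi2 atan_ltpi2.
have -> : sin (atan s) = s * cos (atan s) by rewrite -{2}[s]atanK /tan divfK.
have yn : y != 0 by rewrite gt_eqF.
have e : (t - x) ^+ 2 + y ^+ 2 = (1 + s ^+ 2) * y ^+ 2 by rewrite /s; field.
rewrite e sqrtrM ?addr_ge0 ?sqr_ge0// sqrtr_sqr gtr0_norm// cos_atan /s invfM.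
by rewrite -!mulrA (mulrC _^-1 y^-1).
Qed.

End kernels.

(** * An intermediate value theorem along level curves *)

Section level_curves.
Context {R : realType}.

(* Because [H] increases along horizontal lines, a level set of [H] is the
   graph of a continuous function of [y], along which the intermediate value
   theorem applies to [L]. *)
Lemma level_curve_IVT (H L : R -> R -> R) (x0 y0 l : R) :
  0 < y0 ->
  (forall x x' y, 0 < y -> x < x' -> H x y < H x' y) ->
  (forall x y, 0 < y -> {for y, continuous (H x)}) ->
  (forall y, 0 < y -> exists x, H x y = H x0 y0) ->
  (forall x y e, 0 < y -> 0 < e -> exists2 d, 0 < d &
     forall x' y', `|x - x'| < d -> `|y - y'| < d ->
       `|L x y - L x' y'| <= e) ->
  (forall x y, 0 < y -> ln y <= L x y) ->
  L x0 y0 <= l ->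
  exists x y, [/\ 0 < y, H x y = H x0 y0 & L x y = l].
Proof.
move=> y00 Hincr Hcont Hlevel Lcont Lln Ll.
have Hle x x' y : 0 < y -> H x y < H x' y -> x < x'.
  move=> yp; apply: contraTT; rewrite -!leNgt le_eqVlt => /predU1P[->//|xx].
  exact/ltW/Hincr.
pose g y : R := xget x0 [set x | H x y = H x0 y0].
have gP y : 0 < y -> H (g y) y = H x0 y0.
  by move=> /Hlevel[x Hx]; rewrite /g; case: xgetP => // /(_ x).
(* At height [y] the values of [H] at [g y - e] and [g y + e] lie strictly below and above the
   level. By continuity in the second variable this persists at nearby [y'], and monotonicity traps
   [g y'] between the two points. *)
have g_cont y : 0 < y -> {for y, continuous g}.
  move=> yp; apply/cvgrPdist_lt => e e0; near=> y'.
  have y'p : 0 < y' by near: y'; exact: lt_nbhsr.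
  rewrite ltr_norml; apply/andP; split.
    rewrite ltrNl opprB ltrBlDr; apply: (Hle _ _ y' y'p).
    rewrite gP//; near: y'; apply: (cvgr_gt _ (Hcont _ y yp)).
    by rewrite -(gP y yp); apply: Hincr; rewrite // ltrDr.
  rewrite ltrBlDl -ltrBlDr; apply: (Hle _ _ y' y'p).
  rewrite gP//; near: y'; apply: (cvgr_lt _ (Hcont _ y yp)).
  by rewrite -(gP y yp); apply: Hincr; rewrite // ltrBlDr ltrDl.
(* At the height [y1 >= expR l] the bound [ln y <= L x y] pushes [L] above [l]. *)
pose y1 := Num.max y0 (expR l).
have y01 : y0 <= y1 by rewrite le_max lexx.
have gy0 : g y0 = x0.
  have := gP y0 y00; have [xx|xx|//] := ltgtP (g y0) x0.
    by have := Hincr _ _ _ y00 xx; lra.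
  by have := Hincr _ _ _ y00 xx; lra.
have [||c] := @IVT R (fun y => L (g y) y) y0 y1 l y01.
- apply: continuous_in_subspaceT => y; rewrite inE/= in_itv/= => /andP[yy _].
  have yp := lt_le_trans y00 yy.
  apply/cvgrPdist_le => e e0; have [d d0 dP] := Lcont (g y) y e yp e0.
  near=> y'; apply: dP.
  - by near: y'; apply: (cvgr_dist_lt _ _ (g_cont y yp)).
  - by near: y'; apply: cvgr_dist_lt => //; exact: cvg_id.
- rewrite gy0 ge_min le_max Ll/=; apply/orP; right.
  apply: le_trans (Lln _ _ (lt_le_trans y00 y01)).
  rewrite -[leLHS]expRK ler_ln ?posrE ?expR_gt0 ?(lt_le_trans y00)//.
  by rewrite le_max lexx orbT.
rewrite in_itv/= => /andP[yc _] Lc; have cp := lt_le_trans y00 yc.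
by exists (g c), c; rewrite gP.
Unshelve. all: by end_near. Qed.

End level_curves.

(** * The function [w] on the upper half plane *)

Section w_function.
Context {R : realType}.
Variables (mu : probability (jacobi2 R) R) (dk : probability R R).
Hypothesis dk1 : dk interval22 = 1%E.
Implicit Types x y : R.

Definition arg_integral x y : R :=
  \int[dk]_(t in interval22) arg_kernel x y t.

Definition log_integral x y : R :=
  \int[dk]_(t in interval22) log_kernel x y t.

Lemma w_functionE x y : 0 < y ->
  w_function mu dk (x +i* y)%C =
  ((lnA mu - log_integral x y) +i* arg_integral x y)%C.
Proof.
move=> y0; rewrite /w_function /Cintegral.
have e t : lnC_lower (t%:C%C - (x +i* y)%C) =
    (log_kernel x y t +i* - arg_kernel x y t)%C.
  by rewrite -lnC_lowerE//; congr lnC_lower; apply/eqP;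
    rewrite eq_complex /= sub0r !eqxx.
under eq_Rintegral do rewrite e /=.
under [X in (_ +i* X)%C]eq_Rintegral do rewrite e /= -sub0r.
rewrite Rintegral22B//; [|by move=> ?; exact: cvg_cst|
  exact: continuous_arg_kernel].
apply/eqP; rewrite eq_complex /= Rintegral22_cst// !sub0r opprK.
by rewrite /log_integral /arg_integral !eqxx.
Qed.

Lemma arg_integral_incr x x' y : 0 < y -> x < x' ->
  arg_integral x y < arg_integral x' y.
Proof.
move=> y0 xx; apply: lt_Rintegral22 => //; do ?exact: continuous_arg_kernel.
move=> t _; rewrite /arg_kernel ltrD2l ltrN2; apply: lt_atan.
by rewrite ltr_pM2r ?invr_gt0// ltrD2l ltrN2.
Qed.

Lemma arg_integral_bound x y : 0 < arg_integral x y < pi.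
Proof.
rewrite -{1}(Rintegral22_cst dk dk1 0) -(Rintegral22_cst dk dk1 pi).
apply/andP; split; apply: lt_Rintegral22 => //;
  do ?[exact: continuous_arg_kernel | by move=> ?; exact: cvg_cst];
  by move=> t _; case/andP: (arg_kernel_bound x y t).
Qed.

Lemma arg_integral_dist x y x' y' e :
  (forall t, -2 <= t <= 2 -> `|(t - x) / y - (t - x') / y'| <= e) ->
  `|arg_integral x y - arg_integral x' y'| <= e.
Proof.
move=> h; apply: Rintegral22_dist => //; do ?exact: continuous_arg_kernel.
move=> t /h; apply: le_trans; rewrite /arg_kernel.
rewrite (_ : _ - _ = atan ((t - x') / y') - atan ((t - x) / y)); last by ring.
by rewrite [leRHS]distrC; exact: atan_lipschitz.
Qed.

Lemma continuous_arg_integral_Re x y : 0 < y ->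
  {for x, continuous (arg_integral ^~ y)}.
Proof.
move=> y0; apply/cvgrPdist_le => e e0; near=> x'.
apply: arg_integral_dist => t _.
rewrite -mulrBl (_ : _ - _ = x' - x); last by ring.
rewrite normrM [`|y^-1|]gtr0_norm ?invr_gt0// ler_pdivrMr// distrC.
by near: x'; apply: cvgr_dist_le; [exact: cvg_id | exact: mulr_gt0].
Unshelve. all: by end_near. Qed.

Lemma continuous_arg_integral_Im x y : 0 < y ->
  {for y, continuous (arg_integral x)}.
Proof.
move=> y0; apply/cvgrPdist_le => e e0; near=> y'.
apply: arg_integral_dist => t t2.
rewrite -mulrBr normrM; apply: (@le_trans _ _ ((2 + `|x|) * `|y^-1 - y'^-1|)).
  apply: ler_wpM2r => //; apply: le_trans (ler_normB _ _) _.
  by rewrite lerD2r ler_norml.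
have x2 : 0 < 2 + `|x| by rewrite ltr_wpDr.
rewrite mulrC -ler_pdivlMr//; near: y'.
have cV : (fun z : R => z^-1) @ y --> y^-1 by apply: cvgV; rewrite ?gt_eqF.
by apply: (cvgr_dist_le _ _ cV); exact: divr_gt0.
Unshelve. all: by end_near. Qed.

(** The kernel takes the value [th] when [(t - x) / y] equals [s], the cotangent of [th]. At
    [x = - 2 - s * y] this quotient is at least [s] for every [t] in [[-2, 2]], and at
    [x = 2 - s * y] at most [s]; the intermediate value theorem applies in between. *)
Lemma arg_integral_surj y th : 0 < y -> 0 < th < pi ->
  exists x, arg_integral x y = th.
Proof.
move=> y0 th0pi; pose s := tan (pi / 2 - th).
have sK : atan s = pi / 2 - th.
  by apply: tanK; rewrite in_itv/=; move: th0pi (@pi_gt0 R); lra.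
have bound (x : R) : (forall t, -2 <= t <= 2 -> s <= (t - x) / y) ->
    arg_integral x y <= th.
  move=> h; rewrite -(Rintegral22_cst dk dk1 th).
  apply: le_Rintegral22 => //;
    do ?[exact: continuous_arg_kernel | by move=> ?; exact: cvg_cst].
  by move=> t /h /le_atan; rewrite sK /arg_kernel; lra.
have bound' (x : R) : (forall t, -2 <= t <= 2 -> (t - x) / y <= s) ->
    th <= arg_integral x y.
  move=> h; rewrite -(Rintegral22_cst dk dk1 th).
  apply: le_Rintegral22 => //;
    do ?[exact: continuous_arg_kernel | by move=> ?; exact: cvg_cst].
  by move=> t /h /le_atan; rewrite sK /arg_kernel; lra.
have ab : - 2 - s * y <= 2 - s * y by lra.
have [||c _ <-] := @IVT R (arg_integral ^~ y) _ _ th ab; last by exists c.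
- apply: continuous_in_subspaceT => x _; exact: continuous_arg_integral_Re.
- rewrite ge_min le_max; apply/andP; split; apply/orP.
    by left; apply: bound => t t2; rewrite ler_pdivlMr//; lra.
  by right; apply: bound' => t t2; rewrite ler_pdivrMr//; lra.
Qed.

Lemma log_integral_ge x y : 0 < y -> ln y <= log_integral x y.
Proof.
move=> y0; rewrite -(Rintegral22_cst dk dk1 (ln y)).
apply: le_Rintegral22 => //; do ?[by move=> ?; exact: cvg_cst].
  exact: continuous_log_kernel.
by move=> t _; exact: log_kernel_ge.
Qed.

Lemma log_integral_dist (m x y x' y' : R) : 0 < m -> m <= y -> m <= y' ->
  `|log_integral x y - log_integral x' y'| <= (`|x - x'| + `|y - y'|) / m.
Proof.
move=> m0 my my'; apply: Rintegral22_dist => //.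
- by apply: continuous_log_kernel; exact: lt_le_trans my.
- by apply: continuous_log_kernel; exact: lt_le_trans my'.
- by move=> t _; exact: log_kernel_dist.
Qed.

Lemma continuous_log_integral x y (e : R) : 0 < y -> 0 < e ->
  exists2 d, 0 < d & forall x' y', `|x - x'| < d -> `|y - y'| < d ->
    `|log_integral x y - log_integral x' y'| <= e.
Proof.
(* The bound [y / 2] keeps [y'] above [y / 2], giving the Lipschitz constant [2 / y]; two increments
   below [e * y / 4] then cost at most [e]. *)
move=> y0 e0; exists (Num.min (y / 2) (e * y / 4)).
  by rewrite lt_min !divr_gt0// mulr_gt0.
move=> x' y'; rewrite !lt_min => /andP[_ xe] /andP[yd ye].
have yy' : y / 2 <= y' by move: yd; rewrite ltr_norml; lra.
apply: le_trans (@log_integral_dist (y / 2) _ _ _ _ _ _ _) _ => //; try lra.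
by rewrite ler_pdivrMr; lra.
Qed.

Lemma w_function_left_ray x0 y0 l : 0 < y0 ->
  l <= complex.Re (w_function mu dk (x0 +i* y0)%C) ->
  exists x y, 0 < y /\ w_function mu dk (x +i* y)%C =
    (l +i* complex.Im (w_function mu dk (x0 +i* y0)%C))%C.
Proof.
move=> y00; rewrite w_functionE//= => ll.
have [|||||| x [y [yp He Le]]] :=
  @level_curve_IVT R arg_integral log_integral x0 y0 (lnA mu - l) y00.
- by move=> *; exact: arg_integral_incr.
- by move=> *; exact: continuous_arg_integral_Im.
- by move=> y yp; apply: arg_integral_surj => //; exact: arg_integral_bound.
- by move=> *; exact: continuous_log_integral.
- by move=> *; exact: log_integral_ge.
- by move: ll; lra.
by exists x, y; split=> //; rewrite w_functionE// He Le subKr.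
Qed.

End w_function.

(** * Polar coordinates and the map taking [zeta] to [- zeta - 1 / zeta] *)

Section complex_plane.
Context {R : realType}.
Implicit Types z w : R[i].

(** The balls of the topology on [R[i]] have radii in [R[i]] itself; this passes to real radii. *)
Lemma nbhs_normc z (A : set R[i]) :
  nbhs z A <-> exists2 e : R, 0 < e & forall w, normc (w - z) < e -> A w.
Proof.
have normcE w : `|w| = ((normc w)%:C)%C by rewrite normc_def; case: w.
split=> [/nbhs_ballP[e /= e0 eA]|[e e0 eA]].
  move: e0; rewrite ltcE => /andP[/eqP Ime Ree]; exists (complex.Re e) => //.
  move=> w wz; apply: eA; rewrite -ball_normE/= distrC normcE ltcE/=.
  by rewrite wz Ime eqxx.
apply/nbhs_ballP; exists (e%:C)%C; first by rewrite /= ltcR.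
by move=> w; rewrite -ball_normE/= distrC normcE ltcR; exact: eA.
Qed.

Lemma normcB z w : normc (z - w) = normc (w - z).
Proof. by rewrite -normcN opprB. Qed.

Lemma normc_ge0 z : 0 <= normc z.
Proof. by case: z => a b; exact: sqrtr_ge0. Qed.

Lemma le_Re_normc z : `|complex.Re z| <= normc z.
Proof.
case: z => a b /=; rewrite -sqrtr_sqr ler_wsqrtr//.
by rewrite lerDl sqr_ge0.
Qed.

Lemma normc_real (s : R) : normc (s%:C)%C = `|s|.
Proof. by rewrite /= expr0n addr0 sqrtr_sqr. Qed.

Lemma polarE (r a : R) : polar r a = ((r%:C)%C * polar 1 a).
Proof. by apply/eqP; rewrite eq_complex /= !mul0r !mul1r subr0 addr0 !eqxx. Qed.

Lemma normc_polar (r a : R) : 0 <= r -> normc (polar r a) = r.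
Proof.
move=> r0; rewrite /= !exprMn -mulrDr cos2Dsin2 mulr1 sqrtr_sqr.
by rewrite ger0_norm.
Qed.

Lemma polar0 (a : R) : polar 0 a = 0.
Proof. by rewrite /polar !mul0r. Qed.

Lemma polarN (r a : R) : polar r (- a) = (polar r a)^*%C.
Proof. by rewrite /polar cosN sinN mulrN. Qed.

(** Angles are determined only modulo [2 * pi], so directions are compared as points of the
    circle. *)
Lemma polar_inj (r s a b : R) : 0 < r -> 0 <= s -> polar r a = polar s b ->
  r = s /\ polar 1 a = polar 1 b.
Proof.
move=> r0 s0 e.
have rs : r = s by rewrite -(normc_polar _ a (ltW r0)) e normc_polar.
split=> //; subst s; move: e; rewrite polarE [RHS]polarE.
by apply: mulfI; rewrite eq_complex /= gt_eqF.
Qed.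

Lemma expC_polar z : expC z = polar (expR (complex.Re z)) (complex.Im z).
Proof. by rewrite polarE /polar !mul1r. Qed.

Lemma Im_joukowski z : z != 0 ->
  complex.Im (- z - z^-1) = complex.Im z * (normc z ^- 2 - 1).
Proof.
case: z => a b; rewrite eq_complex /= => ab.
rewrite sqr_sqrtr ?addr_ge0 ?sqr_ge0// opprK mulrBr mulr1 addrC.
by [].
Qed.

Lemma Im_joukowski_gt0 z : normc z < 1 -> 0 < complex.Im z ->
  0 < complex.Im (- z - z^-1).
Proof.
move=> z1 Imz; have zn : z != 0 by apply: contraTneq Imz => ->; rewrite ltxx.
have nz : 0 < normc z.
  rewrite lt_neqAle normc_ge0 andbT eq_sym; apply: contra zn => /eqP.
  by move/eq0_normc => ->.
rewrite Im_joukowski// mulr_gt0// subr_gt0 invf_gt1 ?exprn_gt0//.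
by rewrite expr_lt1 ?normc_ge0.
Qed.

(** The quadratic equation for [zeta] has two roots with product 1, [u] and its inverse. Since
    [Im z = Im u * (normc u ^- 2 - 1)] is positive, either [u] lies in the upper half disk, or it
    lies in the lower half plane outside the closed disk and its inverse is the required root. *)
Lemma joukowski_inv z : 0 < complex.Im z ->
  exists2 zeta : R[i], normc zeta < 1 /\ 0 < complex.Im zeta &
    - zeta - zeta^-1 = z.
Proof.
move=> Imz; pose s := sqrtc (z ^+ 2 - 4); pose u := (s - z) / 2.
have uE : u * (- z - u) = 1.
  have s2 : s ^+ 2 = z ^+ 2 - 4 by exact: sqr_sqrtc.
  have -> : u * (- z - u) = (z ^+ 2 - s ^+ 2) / 4 by rewrite /u; field.
  by rewrite s2; field.
have un : u != 0.
  by apply/eqP => u0; move/eqP: uE; rewrite u0 mul0r eq_sym oner_eq0.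
have uV : - u - u^-1 = z.
  by apply: (mulfI un); rewrite mulrBr divff// -uE; ring.
have nu : 0 < normc u.
  rewrite lt_neqAle normc_ge0 andbT eq_sym; apply: contra un => /eqP.
  by move/eq0_normc => ->.
have [Imu|Imu|Imu] := ltgtP 0 (complex.Im u).
- exists u => //; split=> //; move: Imz; rewrite -uV Im_joukowski//.
  rewrite pmulr_rgt0//.
  rewrite subr_gt0 invf_gt1 ?exprn_gt0//.
  by rewrite expr_lt1 ?normc_ge0.
- exists u^-1; last by rewrite invrK -uV addrC.
  rewrite normcV; split.
    rewrite invf_lt1//; move: Imz; rewrite -uV Im_joukowski// nmulr_rgt0//.
    rewrite subr_lt0 invf_lt1 ?exprn_gt0//.
    by rewrite expr_gt1 ?normc_ge0.
  case: (u) Imu nu => a b /= b0; rewrite sqrtr_gt0 => ab.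
  by rewrite -mulNr divr_gt0// oppr_gt0.
- by move: Imz; rewrite -uV Im_joukowski// -Imu mul0r ltxx.
Qed.

End complex_plane.

(** * Part (a): the range of the conformal map *)

Section range_of_F.
Context {R : realType}.
Variables (mu : probability (jacobi2 R) R) (dk : probability R R).
Hypothesis dk1 : dk interval22 = 1%E.
Variable F : R[i] -> R[i].
Hypothesis Fderiv : forall zeta, unit_disk zeta -> derivable F zeta 1.
Hypothesis Fconj : forall zeta, unit_disk zeta ->
  F (zeta^*)%C = ((F zeta)^*)%C.
Hypothesis FE : forall zeta, unit_disk zeta -> 0 < complex.Im zeta ->
  F zeta = expC (w_function mu dk (- zeta - zeta^-1)).

Let unit_disk0 : unit_disk (0 : R[i]).
Proof. by rewrite /unit_disk/= expr0n/= addr0 sqrtr0. Qed.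

Lemma conformal_map_continuous zeta (e : R) : unit_disk zeta -> 0 < e ->
  exists2 d : R, 0 < d &
    forall xi, normc (xi - zeta) < d -> normc (F xi - F zeta) < e.
Proof.
move=> /Fderiv /derivable1_diffP /differentiable_continuous cF e0.
have : nbhs zeta (F @^-1` [set w | normc (w - F zeta) < e]).
  by apply: cF; apply/nbhs_normc; exists e.
by move=> /nbhs_normc.
Qed.

(** Along the imaginary axis the modulus of [F] at [iy] is at most [A / (1 / y - y)], which tends to
    0, and [F] is continuous at 0. *)
Lemma conformal_map0 : F 0 = 0.
Proof.
apply: eq0_normc; apply/eqP; rewrite eq_le normc_ge0 andbT.
apply/ler_addgt0Pl => e e0; rewrite addr0.
have e2 : 0 < e / 2 by rewrite divr_gt0.
have [d d0 dP] := conformal_map_continuous 0 _ unit_disk0 e2.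
pose A := expR (lnA mu); have A0 : 0 < A := expR_gt0 _.
(* The three bounds give, in turn, [1 / y - y >= 1 / (2 * y)], closeness to 0 within [d], and
   [2 * A * y <= e / 2]. *)
pose y := Num.min (1 / 2) (Num.min (d / 2) (e / (4 * A))).
have y0 : 0 < y by rewrite !lt_min !divr_gt0// mulr_gt0.
have y1 : y <= 1 / 2 by rewrite ge_min lexx.
have yd : y <= d / 2 by rewrite !ge_min lexx orbT.
have ye : y <= e / (4 * A) by rewrite !ge_min lexx !orbT.
have ny : normc (0 +i* y)%C = y by rewrite /= expr0n add0r sqrtr_sqr gtr0_norm.
have Dy : unit_disk (0 +i* y)%C by rewrite /unit_disk /mkset ny; lra.
have : normc (F (0 +i* y)%C) <= e / 2.
  rewrite FE// expC_polar normc_polar ?expR_ge0//.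
  have zE : (- (0 +i* y) - (0 +i* y)^-1 = 0 +i* (y^-1 - y))%C.
    apply/eqP; rewrite eq_complex /= expr0n/= add0r mul0r subr0 oppr0 eqxx/=.
    by apply/eqP; field; rewrite gt_eqF.
  have vy : (2 * y)^-1 <= y^-1 - y.
    rewrite -subr_ge0 (_ : _ - _ = (1 - 2 * y ^+ 2) / (2 * y)); last first.
      by field; rewrite gt_eqF.
    rewrite divr_ge0 ?mulr_ge0 ?(ltW y0)// subr_ge0.
    have : y * y <= 1 / 2 * (1 / 2) by rewrite ler_pM ?(ltW y0).
    by rewrite expr2; lra.
  have v0 : 0 < y^-1 - y by rewrite (lt_le_trans _ vy)// invr_gt0 mulr_gt0.
  rewrite zE w_functionE//=.
  apply: (@le_trans _ _ (A * (2 * y))); last first.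
    by rewrite mulrA -ler_pdivlMl ?mulr_gt0//; move: ye; rewrite !invfM; lra.
  rewrite -[2 * y]lnK ?posrE ?mulr_gt0// -expRD ler_expR lerD2l.
  rewrite -[ln _]opprK lerN2 -lnV ?posrE ?mulr_gt0//.
  apply: le_trans (log_integral_ge dk dk1 0 _ v0).
  by rewrite ler_ln ?posrE ?invr_gt0 ?mulr_gt0.
have : normc (F 0 - F (0 +i* y)%C) < e / 2.
  by rewrite normcB; apply: dP; rewrite subr0 ny; lra.
have := le_normcD (F 0 - F (0 +i* y)%C) (F (0 +i* y)%C).
by rewrite subrK; lra.
Qed.

(** Shrinking the radius of [F zeta] while keeping its direction means lowering [Re w] to [ln r]
    with [Im w] fixed; the resulting point of the half plane is pulled back to the half disk. *)
Lemma range_radial_upper zeta (r r' a : R) : unit_disk zeta ->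
  0 < complex.Im zeta -> 0 < r < r' -> F zeta = polar r' a ->
  exists2 xi, unit_disk xi & F xi = polar r a.
Proof.
move=> Dz Imz /andP[r0 rr']; rewrite FE//.
have Imw := Im_joukowski_gt0 _ Dz Imz; set z0 := _ - _ in Imw *.
have -> : z0 = (complex.Re z0 +i* complex.Im z0)%C by case: (z0).
rewrite expC_polar => /esym e; have r'0 := lt_trans r0 rr'.
have [r'E aE] := polar_inj _ _ _ _ r'0 (expR_ge0 _) e.
have rw : ln r <= complex.Re
    (w_function mu dk (complex.Re z0 +i* complex.Im z0)%C).
  by rewrite -[leRHS]expRK -r'E ler_ln// ltW.
have [x [y [y0 wE]]] := w_function_left_ray mu dk dk1 _ _ _ Imw rw.
have [xi [Dxi Imxi] xiE] := joukowski_inv (x +i* y)%C y0.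
exists xi => //; rewrite FE// xiE wE expC_polar /= lnK//.
by rewrite polarE -aE -polarE.
Qed.

Lemma conformal_map_real (s : R) :
  unit_disk (s%:C)%C -> complex.Im (F (s%:C)%C) = 0.
Proof.
move=> /Fconj; rewrite conjc_real; case: (F _) => a b [] /=; lra.
Qed.

Lemma range_radial_real (s r r' a : R) : unit_disk (s%:C)%C ->
  0 < r < r' -> F (s%:C)%C = polar r' a ->
  exists2 xi, unit_disk xi & F xi = polar r a.
Proof.
move=> Ds /andP[r0 rr'] Fs; have r'0 := lt_trans r0 rr'.
have sa : sin a = 0.
  have := conformal_map_real s Ds; rewrite Fs /= => /eqP.
  by rewrite mulf_eq0 gt_eqF//= => /eqP.
have Dt (t : R) : 0 <= t <= 1 -> unit_disk ((t * s)%:C)%C.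
  move=> /andP[t0 t1]; rewrite /unit_disk /mkset normc_real normrM ger0_norm//.
  apply: le_lt_trans (_ : `|s| < 1); last by rewrite -normc_real.
  by rewrite ler_piMl.
(* On the segment from 0 to [s], [F] is real and runs from 0 to [r' * cos a], so it takes the
   intermediate value [r * cos a]. *)
pose f (t : R) := complex.Re (F ((t * s)%:C)%C).
have [||c c01 fc] := @IVT R f 0 1 (r * cos a) ler01.
- apply: continuous_in_subspaceT => t; rewrite inE/= in_itv/= => t01.
  apply/cvgrPdist_lt => e e0.
  have [d d0 dP] := conformal_map_continuous _ _ (Dt t t01) e0.
  have s1 : 0 < `|s| + 1 by rewrite ltr_wpDl.
  near=> t'; rewrite /f distrC.
  have -> (z w : R[i]) : complex.Re z - complex.Re w = complex.Re (z - w).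
    by case: z w => ? ? [].
  apply: le_lt_trans (le_Re_normc _) (dP _ _).
  rewrite -rmorphB normc_real -mulrBl normrM.
  apply: (@le_lt_trans _ _ (`|t' - t| * (`|s| + 1))).
    by rewrite ler_wpM2l// lerDl.
  rewrite -ltr_pdivlMr// distrC.
  by near: t'; apply: cvgr_dist_lt; [exact: cvg_id | exact: divr_gt0].
- rewrite /f mul0r mul1r conformal_map0 Fs /=.
  (* The sign of [cos a] decides which endpoint value is the smaller. *)
  have [ca|ca] := leP 0 (cos a).
    rewrite min_l ?max_r ?mulr_ge0// ?(ltW r0) ?(ltW r'0)//=.
    by rewrite ler_wpM2r// ltW.
  rewrite min_r ?max_l ?mulr_ge0_le0 ?(ltW r0) ?(ltW r'0) ?(ltW ca)//.
  by rewrite ler_wnM2r ?(ltW ca)// ltW.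
exists ((c * s)%:C)%C; first by apply: Dt; move: c01; rewrite in_itv.
apply/eqP; rewrite eq_complex conformal_map_real ?sa; last first.
  by apply: Dt; move: c01; rewrite in_itv.
by rewrite /= sa mulr0 eqxx andbT; apply/eqP.
Unshelve. all: by end_near. Qed.

Lemma unit_disk_conj (zeta : R[i]) : unit_disk zeta -> unit_disk (zeta^*)%C.
Proof. by case: zeta => a b; rewrite /unit_disk /= sqrrN. Qed.

Lemma range_conj (w : R[i]) :
  (F @` unit_disk) w -> (F @` unit_disk) (w^*)%C.
Proof.
move=> [zeta Dz <-]; exists (zeta^*)%C; last exact: Fconj.
exact: unit_disk_conj.
Qed.

Lemma range_radial : radial (F @` unit_disk).
Proof.
move=> r r' a /andP[]; rewrite le_eqVlt => /predU1P[<- _ _|r0 rr' [zeta Dz Fz]].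
  by exists 0; rewrite // conformal_map0 polar0.
have rr : 0 < r < r' by rewrite r0.
(* The lower half disk is reduced to the upper one by conjugation, which also reverses the angle. *)
have [Imz|Imz|Imz] := ltgtP 0 (complex.Im zeta).
- have [xi Dxi Fxi] := range_radial_upper _ _ _ _ Dz Imz rr Fz.
  by exists xi.
- have Imz' : 0 < complex.Im (zeta^*)%C.
    by move: Imz; case: (zeta) => ? ?; rewrite /= oppr_gt0.
  have Fz' : F (zeta^*)%C = polar r' (- a) by rewrite polarN Fconj// Fz.
  have [xi Dxi Fxi] :=
    range_radial_upper _ _ _ _ (unit_disk_conj _ Dz) Imz' rr Fz'.
  by rewrite -[a]opprK polarN; apply: range_conj; exists xi.
- have zE : zeta = ((complex.Re zeta)%:C)%C.
    by move: Imz; case: (zeta) => ? ? /= <-.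
  rewrite zE in Dz Fz.
  have [xi Dxi Fxi] := range_radial_real _ _ _ _ Dz rr Fz.
  by exists xi.
Qed.

Lemma range_reflection_symmetric : reflection_symmetric (F @` unit_disk).
Proof.
move=> r a _; rewrite polarN; split; first exact: range_conj.
by move=> /range_conj; rewrite conjcK.
Qed.

End range_of_F.

(** * Part (b): radial sets and semicontinuous heights *)

Section radial_domains.
Context {R : realType}.
Implicit Types (z w : R[i]) (Omega : set R[i]) (h : R[i] -> R).

(** The angle is the [acos] of [Re z / normc z], up to the sign of [Im z]. Confining it to a compact
    interval serves the covering argument for [usc_unit_circle_bound]. *)
Lemma polar_surj z : exists2 a : R, -pi <= a <= pi & z = polar (normc z) a.
Proof.
have [n0|n0] := eqVneq (normc z) 0.
  exists 0; first by rewrite oppr_le0 pi_ge0.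
  by rewrite n0 polar0 (eq0_normc n0).
have np : 0 < normc z by rewrite lt_neqAle normc_ge0 andbT eq_sym.
have Rez : -1 <= complex.Re z / normc z <= 1.
  rewrite -ler_norml normrM normfV [`|normc z|]gtr0_norm// ler_pdivrMr//.
  by rewrite mul1r le_Re_normc.
pose a0 := acos (complex.Re z / normc z).
have a00 : 0 <= a0 by exact: acos_ge0.
have a0pi : a0 <= pi by exact: acos_lepi.
have ca0 : normc z * cos a0 = complex.Re z.
  by rewrite /a0 acosK ?in_itv// mulrC divfK.
have sa0 : normc z * sin a0 = `|complex.Im z|.
  rewrite /a0 sin_acos// -sqrtr_sqr -{1}[normc z]ger0_norm ?normc_ge0//.
  rewrite -sqrtr_sqr -sqrtrM ?sqr_ge0//; congr Num.sqrt.
  have : normc z ^+ 2 = complex.Re z ^+ 2 + complex.Im z ^+ 2.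
    by case: (z) => x y; rewrite /= sqr_sqrtr ?addr_ge0 ?sqr_ge0.
  rewrite expr_div_n mulrBr mulr1 mulrC divfK ?expf_neq0// => ->.
  by rewrite addrC addKr.
have [Imz|Imz] := leP 0 (complex.Im z).
  exists a0; first by rewrite a0pi andbT; move: (@pi_ge0 R); lra.
  apply/eqP; rewrite eq_complex; apply/andP; split; apply/eqP.
    exact: esym ca0.
  by rewrite -[LHS]ger0_norm// -sa0.
exists (- a0); first by rewrite lerN2 a0pi; move: (@pi_ge0 R); lra.
apply/eqP; rewrite polarN eq_complex; apply/andP; split; apply/eqP.
  exact: esym ca0.
by rewrite -[LHS]opprK -[- complex.Im z]ltr0_norm// -sa0.
Qed.

Lemma polarB (r s a : R) : normc (polar r a - polar s a) = `|r - s|.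
Proof.
rewrite polarE [polar s a]polarE -mulrBl -rmorphB normcM normc_polar ?ler01//.
by rewrite mulr1 normc_real.
Qed.

Lemma continuous_polar (a e : R) : 0 < e ->
  \forall b \near a, normc (polar 1 b - polar 1 a) < e.
Proof.
move=> e0; have e2 : 0 < e / 2 by rewrite divr_gt0.
near=> b; rewrite /polar !mul1r.
apply: le_lt_trans (normc_Complex_le _ _) _.
rewrite [e]splitr; apply: ltrD; rewrite distrC; near: b;
  apply: cvgr_dist_lt => //.
  exact: continuous_cos.
exact: continuous_sin.
Unshelve. all: by end_near. Qed.

Lemma unit_circle_polar (a : R) : unit_circle (polar 1 a).
Proof. exact: normc_polar. Qed.

(** Expressed by multiplication by [z] instead of an angle, so that it is a function of the point of
    the circle. *)
Definition radial_height Omega z : R :=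
  1 - sup [set r : R | 0 <= r /\ Omega ((r%:C)%C * z)].

(** * From an open radial set to its height function *)

Section height_of_radial_set.
Variable Omega : set R[i].
Hypothesis OmegaD : Omega `<=` unit_disk.
Hypothesis Omega0 : Omega !=set0.
Hypothesis Oopen : open Omega.
Hypothesis Oradial : radial Omega.

Let ray (a : R) := [set r : R | 0 <= r /\ Omega (polar r a)].

Let radial_heightE (a : R) : radial_height Omega (polar 1 a) = 1 - sup (ray a).
Proof.
congr (1 - sup _); apply/seteqP; split=> r /= [r0].
  by rewrite -polarE.
by rewrite polarE.
Qed.

Let Omega_0 : Omega 0.
Proof.
have [z Oz] := Omega0; have [a _ zE] := polar_surj z.
have [n0|n0] := eqVneq (normc z) 0; first by rewrite -(eq0_normc n0).
rewrite -(polar0 a); apply: (Oradial 0 (normc z) a); last by rewrite -zE.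
by rewrite lexx lt_neqAle normc_ge0 andbT eq_sym.
Qed.

Let ray_sup (a : R) : has_sup (ray a).
Proof.
split; first by exists 0; split; rewrite // polar0.
by exists 1 => r [r0 /OmegaD]; rewrite /unit_disk /mkset normc_polar// => /ltW.
Qed.

(** Openness leaves room to move outwards, so the supremum is not attained; hence the strict
    inequality in [radial_domain]. *)
Let ray_open (r a : R) : 0 <= r -> Omega (polar r a) -> r < sup (ray a).
Proof.
move=> r0 Ora; have /nbhs_normc[e e0 eO] : nbhs (polar r a) Omega.
  exact: open_nbhs_nbhs.
apply: (@lt_le_trans _ _ (r + e / 2)); first by rewrite ltrDl divr_gt0.
apply: sup_upper_bound; first exact: ray_sup.
split; first by rewrite addr_ge0// divr_ge0// ltW.
by apply: eO; rewrite polarB addrC addKr gtr0_norm ?divr_gt0//; lra.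
Qed.

Lemma radial_height_bound zeta : unit_circle zeta ->
  0 <= radial_height Omega zeta < 1.
Proof.
have [a _ zE] := polar_surj zeta; move=> z1; rewrite zE z1 radial_heightE.
rewrite subr_ge0 gtrBl ray_open// ?polar0// andbT.
apply: ge_sup; first by case: (ray_sup a).
by move=> r [r0 /OmegaD]; rewrite /unit_disk /mkset normc_polar// => /ltW.
Qed.

Lemma radial_height_usc :
  upper_semicontinuous_in unit_circle (radial_height Omega).
Proof.
move=> zeta z1 c; have [a _ zE] := polar_surj zeta.
rewrite z1 in zE; rewrite zE radial_heightE ltrBlDr -ltrBlDl => cs.
(* A point of [Omega] on the ray at radius above [1 - c] stays in the open set [Omega] under small
   rotations, which bounds the supremum on nearby rays from below. *)
have [r [r0 Or] cr] := sup_gt (ray_sup a).1 cs.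
have /nbhs_normc[e e0 eO] : nbhs (polar r a) Omega by exact: open_nbhs_nbhs.
have r1 : 0 < r + 1 by rewrite ltr_wpDl.
rewrite /within /=; apply/nbhs_normc.
(* Rotation moves the point by [r] times the distance of the directions; [r + 1] avoids dividing by
   zero when [r = 0]. *)
exists (e / (r + 1)); first exact: divr_gt0.
move=> xi xid xi1; have [b _ xE] := polar_surj xi; rewrite xi1 in xE.
rewrite xE radial_heightE ltrBlDr -ltrBlDl; apply: lt_le_trans cr _.
apply: sup_upper_bound; first exact: ray_sup.
split=> //; apply: eO; rewrite polarE [polar r a]polarE -mulrBr normcM -xE.
rewrite -{1}(mulr1 (r%:C)%C) -[1](_ : polar 1 0 = 1); last first.
  by rewrite /polar cos0 sin0 mulr1 mulr0.
rewrite -polarE normc_polar//.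
apply: (@le_lt_trans _ _ ((r + 1) * normc (xi - polar 1 a))).
  by rewrite ler_wpM2r ?normc_ge0// lerDl.
by rewrite mulrC -ltr_pdivlMr.
Qed.

Lemma radial_domain_height : Omega = radial_domain (radial_height Omega).
Proof.
apply/seteqP; split=> [z Oz|_ [r [a [/andP[r0 rh] ->]]]].
  have [a _ zE] := polar_surj z; exists (normc z), a; split=> //.
  rewrite normc_ge0 radial_heightE subKr ray_open ?normc_ge0//.
  by rewrite -zE.
move: rh; rewrite radial_heightE subKr => /(sup_gt (ray_sup a).1)[s [s0 Os] rs].
by apply: Oradial Os; rewrite r0.
Qed.

End height_of_radial_set.

Lemma radial_height_sym Omega (a : R) : reflection_symmetric Omega ->
  radial_height Omega (polar 1 (- a)) = radial_height Omega (polar 1 a).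
Proof.
move=> Osym; congr (1 - sup _); apply/seteqP; split=> r /= [r0].
  by rewrite -!polarE => Or; split=> //; exact: (Osym r a r0).2.
by rewrite -!polarE => Or; split=> //; exact: (Osym r a r0).1.
Qed.

(** * From a height function to an open radial set *)

Section radial_domain_of_height.
Variable h : R[i] -> R.
Hypothesis h_usc : upper_semicontinuous_in unit_circle h.
Hypothesis h_bound : forall zeta, unit_circle zeta -> 0 <= h zeta < 1.
Hypothesis h_sym : forall alpha : R, h (polar 1 (- alpha)) = h (polar 1 alpha).

Let h_lt1 (a : R) : h (polar 1 a) < 1.
Proof. by have /andP[] := h_bound _ (unit_circle_polar a). Qed.

Lemma radial_domain_polar (r a : R) : 0 < r ->
  radial_domain h (polar r a) <-> r < 1 - h (polar 1 a).
Proof.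
move=> r0; split=> [[s [b [/andP[s0 sh] e]]]|rh].
  by have [-> ->] := polar_inj _ _ _ _ r0 s0 e.
by exists r, a; rewrite (ltW r0).
Qed.

(* Near the origin, openness needs [h] to be bounded away from [1] on the
   circle, whence the compactness argument. *)
Lemma usc_unit_circle_bound : exists2 e : R, 0 < e &
  forall zeta, unit_circle zeta -> h zeta < 1 - e.
Proof.
(* Each angle has a neighbourhood on which [h] stays below some [c < 1], so all [e <= 1 - c] work
   there; compactness of the angle interval makes [e] uniform. *)
have : \forall e \near 0^'+, `[- pi, pi]%classic `<=`
    (fun a : R => h (polar 1 a) < 1 - e).
  apply: (iffLR (compact_near_coveringP _) (@segment_compact _ _ _)).
  move=> a _; pose c := (h (polar 1 a) + 1) / 2.
  have ha := h_lt1 a; have hc : h (polar 1 a) < c by rewrite /c; lra.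
  have c1 : 0 < 1 - c by rewrite /c; lra.
  have /nbhs_normc[d d0 dP] := h_usc _ (unit_circle_polar a) _ hc.
  near=> b e => /=; apply: (@lt_le_trans _ _ c).
    apply: dP; last exact: unit_circle_polar.
    by near: b; exact: continuous_polar.
  rewrite lerBrDr -lerBrDl; near: e; exact: nbhs_right_le.
move=> hnear; near (0 : R)^'+ => e; exists e => // zeta z1.
have [a api ->] := polar_surj zeta; rewrite z1.
suff : `[- pi, pi]%classic `<=` (fun a : R => h (polar 1 a) < 1 - e).
  by apply; rewrite /= in_itv.
by near: e.
Unshelve. all: by end_near. Qed.

Lemma open_radial_domain : open (radial_domain h).
Proof.
rewrite openE => _ [r [a [/andP[r0 rh] ->]]]; rewrite /interior.
move: r0; rewrite le_eqVlt => /predU1P[<-|r0].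
  rewrite polar0; have [e e0 eh] := usc_unit_circle_bound.
  apply/nbhs_normc; exists e => // w; rewrite subr0 => we.
  have [b _ ->] := polar_surj w; exists (normc w), b; split=> //.
  by have := eh _ (unit_circle_polar b); rewrite normc_ge0; lra.
(* The midpoint [c] of [h (polar 1 a)] and [1 - r] separates the two: nearby, [h] stays below [c]
   and the radius below [1 - c]. *)
pose c := (h (polar 1 a) + (1 - r)) / 2.
have hc : h (polar 1 a) < c by rewrite /c; lra.
have cr : 0 < 1 - c - r by rewrite /c; lra.
have /nbhs_normc[d d0 dP] := h_usc _ (unit_circle_polar a) _ hc.
apply/nbhs_normc.
(* The first bound keeps the modulus of [w] below [1 - c]. For the second, [r] times the distance of
   the directions is at most the radial change plus the distance of the points, hence less than
   [d * r]. *)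
exists (Num.min (1 - c - r) (d * r / 2)).
  by rewrite lt_min cr divr_gt0// mulr_gt0.
move=> w; rewrite lt_min => /andP[w1 w2].
have [b _ wE] := polar_surj w; set n := normc w in wE.
have nr : `|n - r| <= normc (w - polar r a).
  have p : normc (polar r a) = r by rewrite normc_polar// ltW.
  rewrite ler_norml lerNl opprB !lerBlDr -{1}p normcB; apply/andP; split.
    by have := le_normcD (polar r a - w) w; rewrite subrK p.
  by have := le_normcD (w - polar r a) (polar r a); rewrite subrK p normcB.
exists n, b; split=> //; rewrite normc_ge0/=.
have : h (polar 1 b) < c.
  apply: dP; last exact: unit_circle_polar.
  have rr : normc (r%:C)%C = r by rewrite normc_real gtr0_norm.
  rewrite -(ltr_pM2l r0) -{1}rr -normcM mulrBr -!polarE.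
  have := le_normcD (polar r b - polar n b) (polar n b - polar r a).
  rewrite addrA subrK polarB distrC -wE.
  by move: w2 nr; lra.
by move: nr w1; rewrite ler_norml; lra.
Qed.

Lemma radial_radial_domain : radial (radial_domain h).
Proof.
move=> r s a /andP[r0 rs] /radial_domain_polar sh; exists r, a; split=> //.
by rewrite r0 (lt_trans rs)// sh// (le_lt_trans r0).
Qed.

Lemma reflection_symmetric_radial_domain :
  reflection_symmetric (radial_domain h).
Proof.
move=> r a; rewrite le_eqVlt => /predU1P[<-|r0].
  by rewrite !polar0; split.
by rewrite !radial_domain_polar// h_sym.
Qed.

End radial_domain_of_height.

End radial_domains.
Theorem proposition2p5 (R : realType) :
  (forall (mu : probability (jacobi2 R) R) (F : R[i] -> R[i]),
     M0 mu -> is_associated_conformal_map mu F ->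
     radial (F @` unit_disk) /\ reflection_symmetric (F @` unit_disk)) /\
  (forall Omega : set R[i], Omega `<=` unit_disk -> Omega !=set0 ->
     ([/\ open Omega, radial Omega & reflection_symmetric Omega] <->
      exists h : R[i] -> R,
        [/\ upper_semicontinuous_in unit_circle h,
            forall zeta, unit_circle zeta -> 0 <= h zeta < 1,
            forall alpha : R, h (polar 1 (- alpha)) = h (polar 1 alpha) &
            Omega = radial_domain h])).
Proof.
split=> [mu F _ [dk [dk1 _] [_ Fder Fconj FE]]|Omega OD O0].
  split; last exact: range_reflection_symmetric.
  exact: (range_radial mu dk dk1 F Fder Fconj FE).
split=> [[Oo Or Os]|[h [h_usc hb hs ->]]].
  exists (radial_height Omega); split.
  - exact: radial_height_usc.
  - exact: radial_height_bound.
  - by move=> a; exact: radial_height_sym.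
  - exact: radial_domain_height.
split.
- exact: open_radial_domain.
- exact: radial_radial_domain.
- exact: reflection_symmetric_radial_domain.
Qed.
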